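(* Let $(\pi_1,\ldots,\pi_n)$ be an autotopy of $C\in\mathcal{P}^n(v,k,\lambda)$. Then any component $\pi_x$ uniquely determines all other components. (That is, if $(\pi_1,\ldots,\pi_n)$ and $(\rho_1,\ldots,\rho_n)$ are autotopies of $C$ and $\pi_x=\rho_x$ for some $x\in\{1,\ldots,n\}$, then $\pi_y=\rho_y$ for all $y\in\{1,\ldots,n\}$.)
   Context: An incidence matrix of a symmetric $(v,k,\lambda)$ design is a $v\times v$ matrix $A$ with $\{0,1\}$-entries satisfying $AA^t=(k-\lambda)I+\lambda J$, where $I$ is the identity matrix and $J$ the all-ones matrix; parameters are assumed nondegenerate, $0\le\lambda<k$. For $n\ge 2$, $\mathcal{P}^n(v,k,\lambda)$ is the set of all functions $C:\{1,\ldots,v\}^n\to\{0,1\}$ such that for all $1\le x<y\le n$ the $2$-projection $\Pi_{xy}(C)$ is an incidence matrix of a symmetric $(v,k,\lambda)$ design; here $\Pi_{xy}(C)$ is the $v\times v$ matrix whose $(i_x,i_y)$-entry is the sum (in characteristic $0$) of $C(i_1,\ldots,i_n)$ over all $n$-tuples in $\{1,\ldots,v\}^n$ with the given coordinates $i_x,i_y$. An autotopy of $C$ is an $n$-tuple $(\pi_1,\ldots,\pi_n)\in (S_v)^n$ such that $C(i_1,\ldots,i_n)=C(\pi_1^{-1}(i_1),\ldots,\pi_n^{-1}(i_n))$ for all $i_1,\ldots,i_n\in\{1,\ldots,v\}$. *)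

(* Defs.v *)
From mathcomp Require Import all_boot all_order all_algebra all_fingroup.
Set Implicit Arguments.
Unset Strict Implicit.
Unset Printing Implicit Defensive.
Import GRing.Theory.
Local Open Scope ring_scope.

(* The ground set {1,...,v} is 'I_v, shifted to start at 0. *)
Definition cell (n v : nat) := {ffun 'I_n -> 'I_v}.

Definition is_incidence_matrix (v k l : nat) (A : 'M[int]_v) : Prop :=
  (forall i j, A i j = 0 \/ A i j = 1) /\
  A *m A^T = (k%:R - l%:R)%:M + l%:R *: const_mx 1.

Definition projection (n v : nat) (C : cell n v -> bool) (x y : 'I_n) :
    'M[int]_v :=
  \matrix_(i, j) \sum_(t : cell n v | (t x == i) && (t y == j))
    (C t)%:R.

Definition is_projection_cube (n v k l : nat) (C : cell n v -> bool) : Prop :=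
  forall x y : 'I_n, (x < y)%N -> is_incidence_matrix k l (projection C x y).

Definition is_autotopy (n v : nat) (C : cell n v -> bool)
    (p : {ffun 'I_n -> 'S_v}) : Prop :=
  forall t : cell n v, C t = C [ffun x => (p x)^-1%g (t x)].

(* Main.v *)
(** The matrix [A A^T = (k - l) I + l J] is positive definite because [l < k],
    so [A] is nonsingular and has neither repeated rows nor repeated columns.
    An autotopy permutes the rows and columns of every 2-projection while
    fixing the projection; two autotopies that agree on the rows would
    therefore, if they disagreed on the columns, produce two equal columns. *)
Require Import Defs.
From mathcomp Require Import all_boot all_order all_algebra all_fingroup.
Import Order.TTheory GRing.Theory Num.Theory.

Local Open Scope ring_scope.

(** A left null vector [u] would give [0 = u A A^T u^T = (k - l) * \sum_i u_i^2 + l * (\sum_i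
    u_i)^2]. Both terms are nonnegative and [k - l > 0], so every [u_i] vanishes. *)
Lemma det_incidence_matrix_neq0 {v k l : nat} {A : 'M[int]_v} :
  (l < k)%N -> is_incidence_matrix k l A -> \det A != 0.
Proof.
move=> lt_lk [_ AAt]; apply/det0P => -[u u_neq0 uA0].
have kl_gt0 : 0 < k%:R - l%:R :> int by rewrite subr_gt0 ltr_nat.
have quad : (u *m (A *m A^T) *m u^T) 0 0 = 0.
  by rewrite mulmxA uA0 !mul0mx mxE.
have sqnormE : (u *m u^T) 0 0 = \sum_i u 0 i ^+ 2.
  by rewrite mxE; apply: eq_bigr => i _; rewrite mxE expr2.
have sumE : (u *m const_mx 1 *m u^T) 0 0 = (\sum_i u 0 i) ^+ 2.
  rewrite mxE expr2 mulr_sumr; apply: eq_bigr => i _; rewrite !mxE.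
  by congr (_ * _); apply: eq_bigr => j _; rewrite mxE mulr1.
move: quad; rewrite AAt mulmxDr mulmxDl mul_mx_scalar -scalemxAr -!scalemxAl.
rewrite mxE [X in X + _]mxE [X in _ + X]mxE sqnormE sumE => quad.
have sqnorm_ge0 : 0 <= \sum_i u 0 i ^+ 2.
  by apply: sumr_ge0 => i _; apply: sqr_ge0.
move/eqP: quad; rewrite paddr_eq0; last 2 first.
- by rewrite mulr_ge0 // ltW.
- by rewrite mulr_ge0 ?sqr_ge0 // ler0n.
rewrite mulf_eq0 (gt_eqF kl_gt0) /= => /andP[/eqP sqnorm0 _].
case/eqP: u_neq0; apply/rowP => i; rewrite [RHS]mxE.
apply/eqP; rewrite -sqrf_eq0; apply/eqP.
by apply: (psumr_eq0P _ sqnorm0) => // j _; apply: sqr_ge0.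
Qed.

Lemma row_inj_of_det_neq0 {R : comNzRingType} {v : nat} {A : 'M[R]_v}
    {i i' : 'I_v} :
  \det A != 0 -> A i =1 A i' -> i = i'.
Proof.
move=> detA eqA; apply/eqP; apply: contraNT detA => neq_i.
by apply/eqP; apply: determinant_alternate eqA.
Qed.

Lemma projection_tr {n v : nat} (C : cell n v -> bool) (x y : 'I_n) :
  (projection C x y)^T = projection C y x.
Proof.
by apply/matrixP => i j; rewrite !mxE; apply: eq_bigl => t; rewrite andbC.
Qed.

(** Applying [p] coordinatewise is a bijection on cells that matches the index sets of the two sums
    and preserves [C]. *)
Lemma projection_autotopy {n v : nat} {C : cell n v -> bool}
    {p : {ffun 'I_n -> 'S_v}} (x y : 'I_n) (i j : 'I_v) :
  is_autotopy C p ->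
  projection C x y (p x i) (p y j) = projection C x y i j.
Proof.
move=> hp; rewrite !mxE.
pose f (t : cell n v) : cell n v := [ffun z => p z (t z)].
pose g (t : cell n v) : cell n v := [ffun z => (p z)^-1%g (t z)].
have fK : cancel f g by move=> t; apply/ffunP => z; rewrite !ffunE permK.
have gK : cancel g f by move=> t; apply/ffunP => z; rewrite !ffunE permKV.
rewrite (reindex f) /=; last by exists g => t _; [apply: fK | apply: gK].
apply: eq_big => [t | t _]; first by rewrite !ffunE !(inj_eq perm_inj).
by rewrite (hp (f t)) -/(g (f t)) fK.
Qed.

(** The design condition covers only [x < y]; the opposite order follows by transposition. *)
Lemma det_projection_neq0 {n v k l : nat} {C : cell n v -> bool}
    {x y : 'I_n} :
  (l < k)%N -> is_projection_cube k l C -> x != y ->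
  \det (projection C x y) != 0.
Proof.
move=> lt_lk hC; rewrite neq_ltn => /orP[lt_xy | lt_yx].
- exact: det_incidence_matrix_neq0 lt_lk (hC _ _ lt_xy).
- by rewrite -projection_tr det_tr (det_incidence_matrix_neq0 lt_lk (hC _ _ lt_yx)).
Qed.

Theorem proposition3p1 (n v k l : nat) (hn : (2 <= n)%N) (hkl : (l < k)%N)
    (C : cell n v -> bool) (hC : is_projection_cube k l C)
    (p r : {ffun 'I_n -> 'S_v}) (hp : is_autotopy C p) (hr : is_autotopy C r)
    (x : 'I_n) :
  p x = r x -> forall y : 'I_n, p y = r y.
Proof.
move=> eq_x y; have [<- // | neq_yx] := eqVneq x y.
rewrite eq_sym in neq_yx.
(* Taking [y] as the row coordinate, it suffices that rows [p y j] and [r y j] of [projection C y x]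
   agree. *)
apply/permP => j; apply: (row_inj_of_det_neq0 (det_projection_neq0 hkl hC neq_yx)).
(* With [i] written as the image under [p x = r x] of its preimage, both entries pull back to the
   same entry in row [j]. *)
move=> i; rewrite -(permKV (p x) i) (projection_autotopy _ _ _ _ hp) eq_x.
by rewrite (projection_autotopy _ _ _ _ hr).
Qed.
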